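(* Let $\mathcal{H}_{(A_0,A)}\subseteq SM(\mathbb{R})^{g+1}$ be a bounded positive homogeneous free spectrahedron with minimal defining tuple $(A_0,A)$. Let $(X_0,X)\in SM_n(\mathbb{R})^{g+1}$ with $X_0\succ 0$ and set $Y=X_0^{-1/2}XX_0^{-1/2}$. Then $(X_0,X)\in\partial^{\mathrm{Arv}}\mathcal{H}_{(A_0,A)}$ if and only if for each nonnegative integer $m\le n$ the only $\beta\in M_n(\mathbb{R})^g$ satisfying $$\ker\Lambda_{(A_0,A)}(I,Y)\subseteq\ker\Lambda_{(A_0,A)}(I_m\oplus 0_{n-m},\beta)$$ is $$\beta=\begin{pmatrix} Y_{11} & Y_{12} \\ 0 & 0_{n-m} \end{pmatrix},$$ where $Y=\begin{pmatrix} Y_{11} & Y_{12} \\ Y_{21} & Y_{22} \end{pmatrix}$ and $\beta$ are written (coordinatewise) with respect to the block decomposition of $I_m\oplus 0_{n-m}$.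
   Context: $SM_n(\mathbb{R})^g$ denotes the set of $g$-tuples of real symmetric $n\times n$ matrices, $SM(\mathbb{R})^g=\bigcup_n SM_n(\mathbb{R})^g$, and $M_n(\mathbb{R})^g$ (resp. $M_{n\times m}(\mathbb{R})^g$) the set of $g$-tuples of real $n\times n$ (resp. $n\times m$) matrices. Products such as $VXW$ and direct sums of tuples are taken coordinatewise. For $(A_0,A)=(A_0,A_1,\dots,A_g)\in SM_d(\mathbb{R})^{g+1}$ and a $(g+1)$-tuple $(X_0,X)=(X_0,X_1,\dots,X_g)$ of (not necessarily symmetric) matrices, $\Lambda_{(A_0,A)}(X_0,X)=\sum_{i=0}^g A_i\otimes X_i$ (Kronecker products). The homogeneous free spectrahedron is $\mathcal{H}_{(A_0,A)}=\{(X_0,X)\in SM(\mathbb{R})^{g+1}:\Lambda_{(A_0,A)}(X_0,X)\succeq 0\}$, and $\mathcal{H}_{(A_0,A)}(n)$ is its intersection with $SM_n(\mathbb{R})^{g+1}$. It is positive if $(1,0,\dots,0)\in\mathbb{R}^{g+1}$ lies in the interior of $\mathcal{H}_{(A_0,A)}(1)$. Set $\mathfrak{H}^{-1}(\mathcal{H}_{(A_0,A)})=\{X\in SM(\mathbb{R})^g:(I,X)\in\mathcal{H}_{(A_0,A)}\}$; $\mathcal{H}_{(A_0,A)}$ is bounded if $\mathfrak{H}^{-1}(\mathcal{H}_{(A_0,A)})$ is bounded, i.e. there is $C>0$ with $C\,I-\sum_{i=1}^gX_i^2\succeq0$ for all its elements $X$. Minimal defining tuple: if $U$ is orthogonal with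 $U^T(A_0,A)U=(A_0^1,A^1)\oplus(A_0^2,A^2)$, the pencils $\Lambda_{(A_0^i,A^i)}$ are called subpencils of $\Lambda_{(A_0,A)}$, and such a subpencil is defining for $\mathcal{H}_{(A_0,A)}$ if $\mathcal{H}_{(A_0^i,A^i)}=\mathcal{H}_{(A_0,A)}$. The tuple $(A_0,A)\in SM_d(\mathbb{R})^{g+1}$ is a minimal defining tuple for $\mathcal{H}_{(A_0,A)}$ if for every invertible $V\in M_d(\mathbb{R})$ no proper subpencil of $\Lambda_{V^T(A_0,A)V}$ is a defining subpencil for $\mathcal{H}_{(A_0,A)}$. Free spectrahedra: for $B\in SM_d(\mathbb{R})^g$, $\mathcal{D}_B=\{X\in SM(\mathbb{R})^g: I+\sum_{i=1}^gB_i\otimes X_i\succeq0\}$. When $A_0\succ0$ (which holds for the minimal defining tuple of a positive homogeneous free spectrahedron), $\mathfrak{H}^{-1}(\mathcal{H}_{(A_0,A)})=\mathcal{D}_{A_0^{-1/2}AA_0^{-1/2}}$ is a free spectrahedron. An element $X\in\mathcal{D}_B$ of size $n$ is in the Arveson boundary $\partial^{\mathrm{Arv}}\mathcal{D}_B$ if $\begin{pmatrix} X & \beta \\ \beta^T & \gamma \end{pmatrix}\in\mathcal{D}_B$ (with $\beta\in M_{n\times m}(\mathbb{R})^g$, $\gamma\in SM_m(\mathbb{R})^g$, $m\ge1$) implies $\beta=0$. For a bounded positive homogeneous free spectrahedron, $(X_0,X)\in SM_n(\mathbb{R})^{g+1}$ is in the Arveson boundary $\partial^{\mathrm{Arv}}\mathcal{H}_{(A_0,A)}$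 if and only if $(X_0,X)$ is unitarily equivalent (simultaneously conjugate by a real orthogonal matrix) to a tuple $(Y_0,Y)\oplus(0,0)$ (the zero summand possibly absent) with $Y_0\succ0$ and $Y_0^{-1/2}YY_0^{-1/2}\in\partial^{\mathrm{Arv}}(\mathfrak{H}^{-1}(\mathcal{H}_{(A_0,A)}))$.
   Formalization: The formal theorem additionally assumes that (X_0,X) lies in the homogeneous free spectrahedron H_(A_0,A) (and n ≥ 1); without membership the ''if'' direction is false, since the kernel condition does not see positivity. *)

(* Defs.v *)
From HB Require Import structures.
From mathcomp Require Import all_boot all_order all_algebra.
From mathcomp Require Import all_classical all_reals.
From mathcomp Require Import topology normedtype.
From mathcomp.real_closed Require Export mxtens.

Set Implicit Arguments.
Unset Strict Implicit.
Unset Printing Implicit Defensive.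

Import Order.TTheory GRing.Theory Num.Theory.
Import numFieldNormedType.Exports.
Local Open Scope classical_set_scope.
Local Open Scope ring_scope.

Section Matrices.
Variable R : realType.

Definition symmx n (M : 'M[R]_n) : Prop := M^T = M.

Definition psdmx n (M : 'M[R]_n) : Prop :=
  symmx M /\ forall v : 'cV[R]_n, 0 <= (v^T *m M *m v) 0 0.

Definition pdmx n (M : 'M[R]_n) : Prop :=
  symmx M /\ forall v : 'cV[R]_n, v != 0 -> 0 < (v^T *m M *m v) 0 0.

(* The two conditions force n = m.  The rectangular type lets U be indexed by
   a sum of block sizes without casts. *)
Definition orthogonal_mx n m (U : 'M[R]_(n, m)) : Prop :=
  U^T *m U = 1%:M /\ U *m U^T = 1%:M.

(* For positive semidefinite M the set below is a singleton, so the default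
   value 0 only matters outside the intended domain. *)
Definition sqrtmx n (M : 'M[R]_n) : 'M[R]_n :=
  xget 0 [set S : 'M[R]_n | psdmx S /\ S *m S = M].

Definition inv_sqrtmx n (M : 'M[R]_n) : 'M[R]_n := invmx (sqrtmx M).

(* Kernels of matrices acting on column vectors; mathcomp's kermx is the row
   kernel. *)
Definition ker_sub p q N (M1 : 'M[R]_(p, N)) (M2 : 'M[R]_(q, N)) : Prop :=
  forall v : 'cV[R]_N, M1 *m v = 0 -> M2 *m v = 0.

End Matrices.

Section Spectrahedra.
Variables (R : realType) (g : nat).

Definition mxtuple n := 'I_g -> 'M[R]_n.

(* A set of tuples of matrices of all sizes. *)
Definition mxset := forall n, mxtuple n -> Prop.

(* A (g+1)-tuple (X_0, X) is passed as two arguments.  X_0 and X need not be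
   symmetric here. *)
Definition pencil d (A0 : 'M[R]_d) (A : mxtuple d) n (X0 : 'M[R]_n)
    (X : mxtuple n) : 'M[R]_(d * n) :=
  A0 *t X0 + \sum_(i < g) A i *t X i.

Definition hspec d (A0 : 'M[R]_d) (A : mxtuple d) n (X0 : 'M[R]_n)
    (X : mxtuple n) : Prop :=
  [/\ symmx X0, forall i, symmx (X i) & psdmx (pencil A0 A X0 X)].

(* Level 1 is viewed as a subset of R^(g+1), coordinate 0 being X_0. *)
Definition hspec_level1 d (A0 : 'M[R]_d) (A : mxtuple d) :
    set 'rV[R]_g.+1 :=
  [set x | hspec A0 A ((x 0 ord0)%:M : 'M[R]_1)
                      (fun i => (x 0 (lift ord0 i))%:M)].

Definition positive_hspec d (A0 : 'M[R]_d) (A : mxtuple d) : Prop :=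
  interior (hspec_level1 A0 A) (delta_mx 0 ord0).

Definition dehomog d (A0 : 'M[R]_d) (A : mxtuple d) : mxset :=
  fun n X => hspec A0 A (1%:M : 'M[R]_n) X.

Definition bounded_mxset (K : mxset) : Prop :=
  exists2 C : R, 0 < C &
    forall n (X : mxtuple n), K n X ->
      psdmx (C%:M - \sum_(i < g) X i *m X i).

Definition bounded_hspec d (A0 : 'M[R]_d) (A : mxtuple d) : Prop :=
  bounded_mxset (dehomog A0 A).

Definition same_hspec d (A0 : 'M[R]_d) (A : mxtuple d)
    e (B0 : 'M[R]_e) (B : mxtuple e) : Prop :=
  forall n (X0 : 'M[R]_n) (X : mxtuple n),
    hspec A0 A X0 X <-> hspec B0 B X0 X.

Definition tuple_congr d e (W : 'M[R]_(d, e)) (A : mxtuple d) : mxtuple e :=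
  fun i => W^T *m A i *m W.

(* Both diagonal blocks have positive size.  Listing the subpencil first is no
   restriction, since permuting the columns of U swaps the blocks. *)
Definition proper_subpencil d (A0 : 'M[R]_d) (A : mxtuple d)
    e (B0 : 'M[R]_e) (B : mxtuple e) : Prop :=
  exists (e' : nat) (C0 : 'M[R]_e') (C : mxtuple e') (U : 'M[R]_(d, e + e')),
    [/\ (0 < e)%N, (0 < e')%N, orthogonal_mx U,
        U^T *m A0 *m U = block_mx B0 0 0 C0 &
        forall i, tuple_congr U A i = block_mx (B i) 0 0 (C i)].

Definition minimal_defining d (A0 : 'M[R]_d) (A : mxtuple d) : Prop :=
  [/\ symmx A0, forall i, symmx (A i) &
      forall (V : 'M[R]_d), V \in unitmx ->
      forall e (B0 : 'M[R]_e) (B : mxtuple e),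
        proper_subpencil (V^T *m A0 *m V) (tuple_congr V A) B0 B ->
        ~ same_hspec B0 B A0 A].

Definition arveson (K : mxset) : mxset := fun n X =>
  K n X /\
  forall m (beta : 'I_g -> 'M[R]_(n, m)) (gamma : mxtuple m),
    (0 < m)%N -> (forall i, symmx (gamma i)) ->
    K (n + m)%N (fun i => block_mx (X i) (beta i) (beta i)^T (gamma i)) ->
    forall i, beta i = 0.

(* The zero summand has size l, possibly 0. *)
Definition arveson_hspec d (A0 : 'M[R]_d) (A : mxtuple d) n (X0 : 'M[R]_n)
    (X : mxtuple n) : Prop :=
  exists (k l : nat) (U : 'M[R]_(n, k + l)) (Y0 : 'M[R]_k) (Y : mxtuple k),
    [/\ (0 < k)%N /\ orthogonal_mx U,
        U^T *m X0 *m U = block_mx Y0 0 0 0,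
        forall i, tuple_congr U X i = block_mx (Y i) 0 0 0,
        pdmx Y0 &
        arveson (dehomog A0 A)
          (fun i => inv_sqrtmx Y0 *m Y i *m inv_sqrtmx Y0)].

End Spectrahedra.

(* Main.v *)
Require Import Defs.
From mathcomp Require Import all_boot all_order all_algebra.
From mathcomp Require Import all_classical all_reals.
From mathcomp Require Import topology normedtype ring lra spectral.
From mathcomp.real_closed Require Import complex.

Set Implicit Arguments.
Unset Strict Implicit.
Unset Printing Implicit Defensive.

Import Order.TTheory GRing.Theory Num.Theory.
Import numFieldNormedType.Exports.
Local Open Scope ring_scope.

(* Put L(b) = sum_i A_i *t b_i.  Since (1 *t P) Lambda(1, Y) = Lambda(P, P Y),
   the tuple b = P Y always satisfies the kernel inclusion for P, so the kernel
   condition for every m amounts to its case m = 0: ker Lambda(1, Y) is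
   contained in ker L(b) only for b = 0.

   If the block tuple (Y, b^T; b, c) is in the spectrahedron, then positivity
   of its pencil forces ker Lambda(1, Y) into ker L(b).  Conversely, positivity
   of the homogeneous spectrahedron gives ker A_0 in ker A_i, hence
   A_i = A_0 C_i, and completing the square shows that (Y, e b^T; e b, 0) is in
   the spectrahedron as soon as Lambda(1, Y) dominates e^2 Q^T (A_0 *t 1) Q
   with Q = sum_i C_i *t b_i; for small e this follows from the kernel
   inclusion. *)

(** * Positive semidefinite matrices: Cauchy-Schwarz, kernels and domination *)

Section SemidefiniteMatrices.
Variable R : realType.

Lemma addmxE m n (A B : 'M[R]_(m, n)) i j : (A + B) i j = A i j + B i j.
Proof. by rewrite mxE. Qed.

Lemma scalemxE m n a (A : 'M[R]_(m, n)) i j : (a *: A) i j = a * A i j.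
Proof. by rewrite mxE. Qed.

Lemma quad_sym n (M : 'M[R]_n) (u v : 'cV[R]_n) : symmx M ->
  (v^T *m M *m u) 0 0 = (u^T *m M *m v) 0 0.
Proof.
move=> sM; have -> : v^T *m M *m u = (u^T *m M *m v)^T; last by rewrite mxE.
by rewrite !trmx_mul trmxK sM mulmxA.
Qed.

Lemma sqnorm_eq0 n (u : 'cV[R]_n) : (u^T *m u) 0 0 = 0 -> u = 0.
Proof.
rewrite mxE => /psumr_eq0P u0; apply/colP => i; rewrite !mxE.
apply/eqP; rewrite -sqrf_eq0; apply/eqP.
have := u0 _ i isT; rewrite mxE -expr2; apply=> j _.
by rewrite mxE -expr2 sqr_ge0.
Qed.

(** The form of [M] at [u + t *: v] is a polynomial in [t] of degree at most two that is nowhere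
    negative. *)
Lemma psdmx_cauchy_schwarz n (M : 'M[R]_n) (u v : 'cV[R]_n) : psdmx M ->
  (u^T *m M *m v) 0 0 ^+ 2 <= (u^T *m M *m u) 0 0 * (v^T *m M *m v) 0 0.
Proof.
case=> sM pM.
set a := (u^T *m M *m u) 0 0; set b := (v^T *m M *m v) 0 0.
set c := (u^T *m M *m v) 0 0; have b_ge0 : 0 <= b by exact: pM.
have ge0 t : 0 <= a + t * c *+ 2 + t * (t * b).
  have -> : a + t * c *+ 2 + t * (t * b) =
      ((u + t *: v)^T *m M *m (u + t *: v)) 0 0; last exact: pM.
  rewrite [(_ + _)^T]linearD /= [(_ *: _)^T]linearZ /= !mulmxDl !mulmxDr.
  rewrite -!scalemxAl -!scalemxAr.
  by rewrite !(addmxE, scalemxE) (quad_sym u v sM) -/a -/b -/c mulr2n !addrA.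
have [b0|b_neq0] := eqVneq b 0.
  have [->|c0] := eqVneq c 0; first by rewrite b0 expr0n mulr0.
  (* With [b = 0] the polynomial is affine in [t]; at this [t] it would equal -1. *)
  have := ge0 (- (a + 1) / (c *+ 2)).
  by rewrite b0 !mulr0 addr0 -mulrnAr divfK ?mulrn_eq0 //; lra.
have bp : 0 < b by rewrite lt_def b_neq0.
(* This [t] minimises the quadratic. *)
have := ge0 (- c / b); rewrite -(pmulr_lge0 _ bp).
have -> : (a + - c / b * c *+ 2 + - c / b * (- c / b * b)) * b = a * b - c ^+ 2.
  by field.
by rewrite subr_ge0.
Qed.

(** Cauchy-Schwarz for the pair [M *m v], [v]: the mixed term is the squared norm of [M *m v]. *)
Lemma psdmx_isotropic n (M : 'M[R]_n) (v : 'cV[R]_n) : psdmx M ->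
  (v^T *m M *m v) 0 0 = 0 -> M *m v = 0.
Proof.
move=> pM v0; have := psdmx_cauchy_schwarz (M *m v) v pM.
rewrite v0 mulr0 -mulmxA => le0; apply: sqnorm_eq0.
by apply/eqP; rewrite -sqrf_eq0 eq_le le0 sqr_ge0.
Qed.

Lemma psdmx_congr m n (P : 'M[R]_(m, n)) (M : 'M[R]_m) :
  psdmx M -> psdmx (P^T *m M *m P).
Proof.
case=> sM pM; split=> [|v].
  by rewrite /symmx !trmx_mul trmxK sM mulmxA.
by have := pM (P *m v); rewrite trmx_mul !mulmxA.
Qed.

Lemma psdmxD n (M N : 'M[R]_n) : psdmx M -> psdmx N -> psdmx (M + N).
Proof.
move=> [sM pM] [sN pN]; split=> [|v]; first by rewrite /symmx linearD /= sM sN.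
by rewrite mulmxDr mulmxDl mxE addr_ge0.
Qed.

Lemma psdmx0 n : psdmx (0 : 'M[R]_n).
Proof. by split=> [|v]; rewrite ?/symmx ?trmx0 // mulmx0 mul0mx mxE. Qed.

Lemma psdmx_sum (I : finType) n (F : I -> 'M[R]_n) :
  (forall i, psdmx (F i)) -> psdmx (\sum_i F i).
Proof. by move=> pF; apply: big_ind => //; [exact: psdmx0|exact: psdmxD]. Qed.

(** The columns of [cokermx M1] lie in the column kernel of [M1], so [M2] annihilates them; this is
    the criterion for inclusion of row spaces. *)
Lemma ker_subP p q N (M1 : 'M[R]_(p, N)) (M2 : 'M[R]_(q, N)) :
  ker_sub M1 M2 -> exists K, M2 = K *m M1.
Proof.
move=> k; apply/submxP; rewrite submxE; apply/eqP/matrixP => i j.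
have /k : M1 *m col j (cokermx M1) = 0
  by rewrite colE mulmxA mulmx_coker mul0mx.
by rewrite colE mulmxA -colE => /colP/(_ i); rewrite !mxE.
Qed.

(** Writing P = M J M turns the form of P at v into that of J at M v. It is at most c |M v|^2, and
    |M v|^2 is at most tr(M) times the form of M at v. *)
Lemma psdmx_dominate n (M P : 'M[R]_n) : psdmx M -> symmx P -> ker_sub M P ->
  exists2 e : R, 0 < e & psdmx (M - e *: P).
Proof.
move=> pM sP kMP; have [sM qM] := pM.
have [J PE] : exists J, P = M *m J *m M.
  (* By symmetry P = K M = M K^T, and P is fixed by right multiplication by [pinvmx M *m M] because
     its rows lie in the row space of M. *)
  have [K PE] := ker_subP kMP; exists (K^T *m pinvmx M).
  by rewrite mulmxA -{1}sM -trmx_mul -PE sP mulmxKpV // PE submxMl.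
pose c := \sum_i \sum_j `|J i j|.
have c_ge0 : 0 <= c by rewrite sumr_ge0 // => i _; rewrite sumr_ge0.
have trM_ge0 : 0 <= \tr M.
  rewrite sumr_ge0 // => i _; have := qM (delta_mx i 0).
  by rewrite trmx_delta -rowE -colE !mxE.
have Jbnd (u : 'cV_n) : (u^T *m J *m u) 0 0 <= c * (u^T *m u) 0 0.
  set s := (u^T *m u) 0 0.
  have us i : `|u i 0| ^+ 2 <= s.
    rewrite real_normK ?num_real // /s mxE (bigD1 i) //= mxE -expr2 lerDl.
    by rewrite sumr_ge0 // => j _; rewrite mxE -expr2 sqr_ge0.
  rewrite -mulmxA mxE mulr_suml ler_sum // => i _.
  rewrite !mxE mulr_sumr mulr_suml ler_sum // => j _.
  rewrite (le_trans (ler_norm _)) // !normrM.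
  have := us i; have := us j; move: (normr_ge0 (J i j)).
  move: `|u i 0| `|u j 0| `|J i j| => a b k k0 b2 a2.
  have ab : a * b <= s by nra.
  nra.
have Mbnd (v : 'cV_n) :
    ((M *m v)^T *m (M *m v)) 0 0 <= \tr M * (v^T *m M *m v) 0 0.
  rewrite mxE mulr_suml ler_sum // => i _.
  (* Entry i of M v, squared, is at most M i i times the form at v; these bounds sum to the
     trace. *)
  have := psdmx_cauchy_schwarz (delta_mx i 0) v pM.
  by rewrite trmx_delta -!rowE -colE -row_mul !mxE -expr2.
(* The summand 1 keeps the denominator positive even when c or the trace vanishes. *)
have e0 : 0 < 1 + c * \tr M by rewrite ltr_wpDr // mulr_ge0.
exists (1 + c * \tr M)^-1; first by rewrite invr_gt0.
split=> [|v]; first by rewrite /symmx linearB linearZ /= sM sP.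
rewrite mulmxBr mulmxBl -scalemxAr -scalemxAl.
rewrite -scaleN1r !(addmxE, scalemxE) mulN1r subr_ge0 mulrC.
rewrite ler_pdivrMr // PE.
have -> : v^T *m (M *m J *m M) *m v = (M *m v)^T *m J *m (M *m v).
  by rewrite trmx_mul sM !mulmxA.
rewrite (le_trans (Jbnd _)) // (le_trans (ler_wpM2l c_ge0 (Mbnd v))) //.
have := qM v; lra.
Qed.

End SemidefiniteMatrices.

(** * Existence and uniqueness of positive semidefinite square roots *)

Section SquareRoot.
Variable R : realType.

(** The spectral theorem over [R[i]] gives real eigenvalues, and real matrices that are similar over
    [R[i]] are similar over [R]. The resulting [P] is merely invertible, not known to be
    orthogonal. *)
Lemma symmx_diagonalizable n (M : 'M[R]_n) : symmx M ->
  exists2 P, P \in unitmx & exists l : 'rV_n, P *m M = diag_mx l *m P.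
Proof.
move=> sM; pose c : {rmorphism R -> R[i]} := real_complex R.
have real_map m p (N : 'M[R]_(m, p)) : map_mx c N \is a realmx.
  by apply/mxOverP => i j; rewrite mxE; apply/complex_realP; exists (N i j).
have real_lift m p (N : 'M[R[i]]_(m, p)) : N \is a realmx ->
    exists N' : 'M[R]_(m, p), N = map_mx c N'.
  move=> /mxOverP rN; exists (map_mx (@complex.Re R) N).
  by apply/matrixP => i j; rewrite !mxE /c /= RRe_real.
have Mherm : map_mx c M \is hermsymmx.
  apply/is_hermitianmxP; rewrite expr0 scale1r.
  by apply/matrixP => i j; rewrite -{1}sM !mxE /=; exact: esym (conjc_real _).
have /orthomx_spectralP ME := hermitian_normalmx Mherm.
have [l lE] := real_lift _ _ _ (hermitian_spectral_diag_real Mherm).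
have sim : simmx_in unitmx (map_mx c M) (map_mx c (diag_mx l)).
  exists (spectralmx (map_mx c M)); first exact: spectral_unit.
  apply/simmxP; rewrite ?spectral_unit //.
  by rewrite {2}ME !mulmxA mulmxV ?spectral_unit // mul1mx map_diag_mx -lE.
have [P /andP[rP uP]] := real_similar sim (real_map _ _ _) (real_map _ _ _).
have [Q PE] := real_lift _ _ _ rP; move: uP; rewrite PE map_unitmx => uQ.
move=> /(simmxP _); rewrite map_unitmx => /(_ uQ); rewrite -!map_mxM.
by move=> /map_mx_inj QM; exists Q => //; exists l.
Qed.

Lemma pdmx_unit n (M : 'M[R]_n) : pdmx M -> M \in unitmx.
Proof.
case=> _ pM; have [K /esym/mulmx1_unit[]//] : exists K, 1%:M = K *m M.
apply: ker_subP => v Mv; apply: contra_eq (erefl (0 : R)) => v0.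
by rewrite mul1mx in v0; have := pM v v0; rewrite -mulmxA Mv mulmx0 mxE ltxx.
Qed.

Lemma psdmx_unit_pdmx n (M : 'M[R]_n) : psdmx M -> M \in unitmx -> pdmx M.
Proof.
move=> pM uM; have [sM qM] := pM; split=> // v v0; rewrite lt_def qM andbT.
apply: contra_neq v0 => /(psdmx_isotropic pM) Mv.
by rewrite -[v](mulKmx uM) Mv mulmx0.
Qed.

(* A matrix commuting with D = diag(l) commutes with diag(f(l)) for every
   function f.  Applied to P P^T, this makes P^-1 diag(f(l)) P symmetric. *)
Lemma symmx_functional_calculus n (M P : 'M[R]_n) (l : 'rV[R]_n) (f : R -> R) :
  symmx M -> P \in unitmx -> P *m M = diag_mx l *m P ->
  symmx (invmx P *m diag_mx (map_mx f l) *m P).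
Proof.
move=> sM uP PM; set F := diag_mx _.
have trD (k : 'rV[R]_n) : (diag_mx k)^T = diag_mx k by rewrite tr_diag_mx.
have PPl : diag_mx l *m (P *m P^T) = P *m P^T *m diag_mx l.
  rewrite mulmxA -PM -!mulmxA; congr (_ *m _).
  by rewrite -{1}sM -trmx_mul PM trmx_mul trD.
have PPF : F *m (P *m P^T) = P *m P^T *m F.
  apply/matrixP => i j; move/matrixP: PPl => /(_ i j).
  rewrite !mul_diag_mx !mul_mx_diag !mxE.
  move: (\sum_k _) => x.
  have [->|ne] := eqVneq (l 0 i) (l 0 j); first by move=> _; rewrite mulrC.
  move=> /eqP; rewrite mulrC -subr_eq0 -mulrBr mulf_eq0 subr_eq0 (negPf ne).
  by rewrite orbF => /eqP->; rewrite mulr0 mul0r.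
rewrite /symmx !trmx_mul trmx_inv trD.
have uPT : P^T \in unitmx by rewrite unitmx_tr.
apply: (can_inj (mulKmx uP)); apply: (can_inj (mulmxK uPT)).
by rewrite !mulmxA mulmxKV // mulmxV // mul1mx -!mulmxA PPF !mulmxA.
Qed.

Lemma psdmx_sqrt_exists n (M : 'M[R]_n) : pdmx M ->
  exists S : 'M[R]_n, psdmx S /\ S *m S = M.
Proof.
move=> [sM pM]; have [P uP [l PM]] := symmx_diagonalizable sM.
(* Row i of [P] is a nonzero left eigenvector, and the form of [M] there is [l 0 i] times its
   squared norm. *)
have l_ge0 i : 0 <= l 0 i.
  have ri : (row i P)^T != 0.
    apply/eqP => /(congr1 trmx); rewrite trmxK trmx0 => ri0.
    have := oner_neq0 R.
    rewrite -[X in _ != X](_ : (row i P *m invmx P) 0 i = _).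
      by rewrite -row_mul mulmxV // !mxE eqxx eqxx.
    by rewrite ri0 mul0mx mxE.
  have := pM _ ri; rewrite trmxK -row_mul PM row_mul row_diag_mx.
  rewrite -scalemxAl -rowE -scalemxAl mxE pmulr_lgt0 => [/ltW //|].
  rewrite lt_def; apply/andP; split.
    by apply/eqP => ri0; move/eqP: ri; apply; apply: sqnorm_eq0; rewrite trmxK.
  by rewrite mxE sumr_ge0 // => j _; rewrite !mxE -expr2 sqr_ge0.
pose phi f := invmx P *m diag_mx (map_mx f l) *m P.
have phiM f h k : (forall i, f (l 0 i) * h (l 0 i) = k (l 0 i)) ->
    phi f *m phi h = phi k.
  move=> fh; rewrite /phi !mulmxA mulmxK // -!mulmxA; congr (_ *m _).
  rewrite !mulmxA; congr (_ *m _); rewrite mulmx_diag; congr diag_mx.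
  by apply/rowP => i; rewrite !mxE fh.
have sphi f : symmx (phi f) by exact: symmx_functional_calculus PM.
pose r := @Num.sqrt R; exists (phi r); split; last first.
  rewrite (phiM _ _ id) => [|i]; last by rewrite -expr2 sqr_sqrtr.
  by rewrite /phi map_mx_id // -mulmxA -PM mulKmx.
(* The root is itself the square of the symmetric fourth root [phi (r \o r)], so its form is a sum
   of squares. *)
split=> // v; rewrite -(phiM (r \o r) (r \o r)) => [|i]; last first.
  by rewrite /= -expr2 sqr_sqrtr // sqrtr_ge0.
rewrite mulmxA -mulmxA -{1}sphi -trmx_mul mxE sumr_ge0 // => i _.
by rewrite mxE -expr2 sqr_ge0.
Qed.

(* With D = S - T and Q = S + T the hypothesis reads D Q + Q D = 0, so
   tr (D Q D) = 0 although D Q D is positive semidefinite. *)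
Lemma psdmx_sqrt_unique n (S T : 'M[R]_n) : psdmx S -> psdmx T ->
  S \in unitmx -> S *m S = T *m T -> S = T.
Proof.
move=> pS pT uS ST; have [sS qS] := psdmx_unit_pdmx pS uS; have [sT qT] := pT.
set D := S - T; pose Q := S + T.
have sD : D^T = D by rewrite /D linearB /= sS sT.
have DQ : D *m Q = S *m T - T *m S.
  by rewrite mulmxBl !mulmxDr ST opprD [- _ - _]addrC addrACA subrr add0r.
have QD : Q *m D = T *m S - S *m T.
  by rewrite mulmxDl !mulmxBr ST [LHS]addrC addrA subrK.
have tr0 : \tr (D *m Q *m D) = 0.
  have := mxtrace_mulC (D *m Q) D.
  have -> : D *m (D *m Q) = - (D *m Q *m D).
    by rewrite -[in RHS]mulmxA QD DQ -opprB mulmxN.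
  by rewrite linearN /=; lra.
have qQ (v : 'cV[R]_n) : v != 0 -> 0 < (v^T *m Q *m v) 0 0.
  by move=> /qS; rewrite mulmxDr mulmxDl addmxE => qv; rewrite ltr_wpDr.
have DQDE i : (D *m Q *m D) i i = ((col i D)^T *m Q *m col i D) 0 0.
  by rewrite colE trmx_mul sD trmx_delta -!mulmxA -rowE !mulmxA -colE !mxE.
have DQD_ge0 i : 0 <= (D *m Q *m D) i i.
  rewrite DQDE; have [->|/qQ/ltW//] := eqVneq (col i D) 0.
  by rewrite mulmx0 mxE.
apply/eqP; rewrite -subr_eq0; apply/eqP/matrixP => i j.
(* The diagonal entries of D Q D are nonnegative with sum zero, so each vanishes; since Q is
   positive definite, so does each column of D. *)
have colj : col j D = 0.
  have : (D *m Q *m D) j j = 0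
    by exact: psumr_eq0P (fun i _ => DQD_ge0 i) tr0 _ isT.
  by apply: contraPeq => /qQ; rewrite -DQDE => /lt0r_neq0/eqP.
by have /colP/(_ i) := colj; rewrite !mxE.
Qed.

Lemma sqrtmxP n (M : 'M[R]_n) : pdmx M ->
  psdmx (sqrtmx M) /\ sqrtmx M *m sqrtmx M = M.
Proof. by move=> /psdmx_sqrt_exists exS; exact: (xgetPex 0 exS). Qed.

Lemma sqrtmx_unit n (M : 'M[R]_n) : pdmx M -> sqrtmx M \in unitmx.
Proof.
move=> pM; have [_ SM] := sqrtmxP pM; have := pdmx_unit pM.
by rewrite -{1}SM unitmx_mul andbb.
Qed.

Lemma inv_sqrtmx_sym n (M : 'M[R]_n) : pdmx M -> symmx (inv_sqrtmx M).
Proof. by move=> /sqrtmxP[[sS _] _]; rewrite /symmx trmx_inv sS. Qed.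

Lemma inv_sqrtmx_congr n (M : 'M[R]_n) : pdmx M ->
  inv_sqrtmx M *m M *m inv_sqrtmx M = 1%:M.
Proof.
move=> pM; have [_ {2}<-] := sqrtmxP pM.
by rewrite mulKmx ?mulmxV ?sqrtmx_unit.
Qed.

(** By uniqueness of square roots, conjugating the root of [M] by [U] gives the root of the
    conjugate. *)
Lemma inv_sqrtmx_orthogonal n m (M : 'M[R]_n) (U : 'M[R]_(n, m)) : pdmx M ->
  orthogonal_mx U -> pdmx (U^T *m M *m U) ->
  inv_sqrtmx (U^T *m M *m U) = U^T *m inv_sqrtmx M *m U.
Proof.
move=> pM [UtU UUt] pN; have [pS SM] := sqrtmxP pM; have [pT TN] := sqrtmxP pN.
have UK p (B : 'M_(p, n)) : B *m U *m U^T = B by rewrite -mulmxA UUt mulmx1.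
have uT := sqrtmx_unit pN.
have TE : sqrtmx (U^T *m M *m U) = U^T *m sqrtmx M *m U.
  apply: psdmx_sqrt_unique => //; first exact: psdmx_congr.
  by rewrite TN -{1}SM !mulmxA UK.
apply: (can_inj (mulmxK uT)); rewrite mulVmx // TE !mulmxA UK.
by rewrite mulmxKV ?sqrtmx_unit.
Qed.

End SquareRoot.

(** * Kronecker products, pencils and consequences of positivity *)

Section Pencils.
Variable R : realType.

Lemma tensmxDl m n p q (A B : 'M[R]_(m, n)) (C : 'M[R]_(p, q)) :
  (A + B) *t C = A *t C + B *t C.
Proof. by apply/matrixP => i j; rewrite !mxE mulrDl. Qed.

Lemma tensmxDr m n p q (A : 'M[R]_(m, n)) (B C : 'M[R]_(p, q)) :
  A *t (B + C) = A *t B + A *t C.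
Proof. by apply/matrixP => i j; rewrite !mxE mulrDr. Qed.

Lemma tensmx_sumr (I : finType) m n p q (A : 'M[R]_(m, n))
    (F : I -> 'M[R]_(p, q)) : A *t (\sum_i F i) = \sum_i A *t F i.
Proof.
by elim/big_ind2: _ => [|x B y C <- <-|//]; rewrite ?tensmx0 ?tensmxDr.
Qed.

Lemma tensmxZr m n p q a (A : 'M[R]_(m, n)) (B : 'M[R]_(p, q)) :
  A *t (a *: B) = a *: (A *t B).
Proof. by apply/matrixP => i j; rewrite !mxE mulrCA. Qed.

Lemma tensmx11 m n : (1%:M : 'M[R]_m) *t (1%:M : 'M[R]_n) = 1%:M.
Proof.
apply/matrixP => i j; case: (mxtens_indexP i) => i1 i2.
case: (mxtens_indexP j) => j1 j2; rewrite tensmxE !mxE.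
by rewrite (can_eq (@mxtens_indexK m n)) xpair_eqE -natrM mulnb.
Qed.

Variable g : nat.

(** Rectangular coefficients are allowed, so that it also describes the off-diagonal blocks of a
    dilation. *)
Definition linpencil d (A : 'I_g -> 'M[R]_d) p q (b : 'I_g -> 'M[R]_(p, q)) :
  'M[R]_(d * p, d * q) := \sum_(i < g) A i *t b i.

Lemma linpencilD d (A : 'I_g -> 'M[R]_d) p q (b c : 'I_g -> 'M[R]_(p, q)) :
  linpencil A (fun i => b i + c i) = linpencil A b + linpencil A c.
Proof. by rewrite -big_split; apply: eq_bigr => i _; rewrite tensmxDr. Qed.

Lemma linpencilZ d (A : 'I_g -> 'M[R]_d) p q a (b : 'I_g -> 'M[R]_(p, q)) :
  linpencil A (fun i => a *: b i) = a *: linpencil A b.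
Proof. by rewrite scaler_sumr; apply: eq_bigr => i _; rewrite tensmxZr. Qed.

Lemma linpencil_mul d (A : 'I_g -> 'M[R]_d) p q r s (P : 'M[R]_(r, p))
    (b : 'I_g -> 'M[R]_(p, q)) (Q : 'M[R]_(q, s)) :
  linpencil A (fun i => P *m b i *m Q) =
  (1%:M *t P) *m linpencil A b *m (1%:M *t Q).
Proof.
rewrite mulmx_sumr mulmx_suml; apply: eq_bigr => i _.
by rewrite !tensmx_mul mul1mx mulmx1.
Qed.

Lemma linpencil_tr d (A : 'I_g -> 'M[R]_d) p q (b : 'I_g -> 'M[R]_(p, q)) :
  (forall i, symmx (A i)) ->
  linpencil A (fun i => (b i)^T) = (linpencil A b)^T.
Proof.
move=> sA; rewrite /linpencil linear_sum; apply: eq_bigr => i _ /=.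
by rewrite trmx_tens sA.
Qed.

Lemma pencilE d (A0 : 'M[R]_d) (A : 'I_g -> 'M[R]_d) n (X0 : 'M[R]_n) X :
  pencil A0 A X0 X = A0 *t X0 + linpencil A X.
Proof. by []. Qed.

Lemma pencil_congr d (A0 : 'M[R]_d) (A : 'I_g -> 'M[R]_d) n m
    (P : 'M[R]_(n, m)) (X0 : 'M[R]_n) X :
  pencil A0 A (P^T *m X0 *m P) (fun i => P^T *m X i *m P) =
  (1%:M *t P)^T *m pencil A0 A X0 X *m (1%:M *t P).
Proof.
rewrite !pencilE linpencil_mul mulmxDr mulmxDl trmx_tens trmx1.
by rewrite !tensmx_mul mul1mx mulmx1.
Qed.

Lemma pencil_mull d (A0 : 'M[R]_d) (A : 'I_g -> 'M[R]_d) n (P : 'M[R]_n) X :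
  pencil A0 A P (fun i => P *m X i) = (1%:M *t P) *m pencil A0 A 1%:M X.
Proof.
rewrite !pencilE mulmxDr tensmx_mul mul1mx mulmx1; congr (_ + _).
rewrite mulmx_sumr; apply: eq_bigr => i _.
by rewrite tensmx_mul mul1mx.
Qed.

Lemma hspec_congr d (A0 : 'M[R]_d) (A : 'I_g -> 'M[R]_d) n m
    (P : 'M[R]_(n, m)) (X0 : 'M[R]_n) X :
  hspec A0 A X0 X -> hspec A0 A (P^T *m X0 *m P) (fun i => P^T *m X i *m P).
Proof.
case=> sX0 sX pX; split=> [|i|].
- by rewrite /symmx !trmx_mul trmxK sX0 mulmxA.
- by rewrite /symmx !trmx_mul trmxK sX mulmxA.
- by rewrite pencil_congr; exact: psdmx_congr.
Qed.

(** The point (1, 0, ..., 0) belongs to level 1, which is the case n = 1; the general case is a sum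
    of congruences by [1%:M *t delta_mx 0 j]. *)
Lemma positive_hspec_psd d (A0 : 'M[R]_d) (A : 'I_g -> 'M[R]_d) n :
  positive_hspec A0 A -> psdmx (A0 *t (1%:M : 'M[R]_n)).
Proof.
move=> /nbhs_singleton[_ _].
have -> : pencil A0 A ((delta_mx 0 ord0 : 'rV[R]_g.+1) 0 ord0)%:M
    (fun i => ((delta_mx 0 ord0 : 'rV[R]_g.+1) 0 (lift ord0 i))%:M) =
    A0 *t (1%:M : 'M[R]_1).
  rewrite pencilE /linpencil big1 ?addr0 => [|i _]; first by rewrite mxE !eqxx.
  by rewrite mxE andbF raddf0 tensmx0.
move=> pA0.
rewrite (_ : 1%:M = \sum_(j < n) (delta_mx 0 j : 'rV[R]_n)^T *m delta_mx 0 j).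
  rewrite tensmx_sumr; apply: psdmx_sum => j.
  have := psdmx_congr (1%:M *t (delta_mx 0 j : 'rV[R]_n)) pA0.
  by rewrite trmx_tens trmx1 !tensmx_mul mul1mx !mulmx1.
rewrite mx1_sum_delta; apply: eq_bigr => j _.
by rewrite trmx_delta mul_delta_mx.
Qed.

Lemma psdmx_tens1 d (M : 'M[R]_d) : psdmx (M *t (1%:M : 'M[R]_1)) -> psdmx M.
Proof.
case=> sM qM; split=> [|w].
  apply/matrixP => i j; move/matrixP: sM.
  move=> /(_ (mxtens_index (i, 0)) (mxtens_index (j, 0))).
  by rewrite trmx_tens !tensmxE trmx1 !mxE eqxx !mulr1.
pose k : 'I_(1 * 1) := mxtens_index (0 : 'I_1, 0 : 'I_1).
have -> : (w^T *m M *m w) 0 0 =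
    ((w *t (1%:M : 'M_1))^T *m (M *t 1%:M) *m (w *t 1%:M)) k k.
  by rewrite trmx_tens !tensmx_mul trmx1 !mul1mx tensmxE [1%:M _ _]mxE mulr1.
by have -> : k = 0 by [exact: val_inj]; exact: qM.
Qed.

(** An interior point of level 1 can be moved slightly along coordinate i without leaving level
    1. *)
Lemma positive_hspec_perturb d (A0 : 'M[R]_d) (A : 'I_g -> 'M[R]_d) i :
  positive_hspec A0 A -> \forall s \near (0 : R), psdmx (A0 + s *: A i).
Proof.
move=> posA; pose h (s : R) : 'rV[R]_g.+1 :=
  delta_mx 0 ord0 + s *: delta_mx 0 (lift ord0 i).
have h0 : h 0 = delta_mx 0 ord0 by rewrite /h scale0r addr0.
have hc : {for 0, continuous h}.
  by apply: cvgD; [exact: cvg_cst|exact: scalel_continuous].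
have hnear : \forall s \near 0, hspec_level1 A0 A (h s).
  by apply: hc; rewrite h0.
apply: filterS hnear => s [_ _ ps]; apply: psdmx_tens1.
suff <- : pencil A0 A ((h s) 0 ord0)%:M (fun j => (h s 0 (lift ord0 j))%:M) =
  (A0 + s *: A i) *t (1%:M : 'M_1) by [].
rewrite tensmxDl pencilE; congr (_ *t _ + _).
  by rewrite /h !mxE !eqxx mulr0 addr0.
rewrite /linpencil (bigD1 i) //= big1 ?addr0 => [|j ji].
  rewrite /h !mxE !eqxx /= add0r mulr1 -[s%:M]scalemx1 tensmxZr.
  by apply/matrixP => k l; rewrite !mxE mulrA.
rewrite /h !mxE (inj_eq lift_inj) (negPf ji) andbF.
by rewrite mulr0 addr0 raddf0 tensmx0.
Qed.

(** For w in the kernel of A0, the matrices A0 + t A_i and A0 - t A_i give opposite nonnegative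
    values at w. Both are zero, so w is isotropic, hence in the kernel of A0 + t A_i. *)
Lemma positive_hspec_ker d (A0 : 'M[R]_d) (A : 'I_g -> 'M[R]_d) i :
  positive_hspec A0 A -> ker_sub A0 (A i).
Proof.
move=> /(@positive_hspec_perturb _ _ _ i) near0 w A0w.
have [e /= e0 be] := near0.
have psd s : `|s| < e -> psdmx (A0 + s *: A i).
  by move=> se; apply: be; rewrite /= sub0r normrN.
pose t := e / 2; have t0 : 0 < t by rewrite divr_gt0.
have te : `|t| < e by rewrite gtr0_norm // ltr_pdivrMr // ltr_pMr // ltr1n.
have quad s : (w^T *m (A0 + s *: A i) *m w) 0 0 = s * (w^T *m A i *m w) 0 0.
  by rewrite mulmxDr mulmxDl -(mulmxA _ A0) A0w mulmx0 add0r -scalemxAr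
     -scalemxAl mxE.
have [_ /(_ w)] := psd _ te; rewrite quad => ge0.
have [_ /(_ w)] : psdmx (A0 + - t *: A i) by apply: psd; rewrite normrN.
rewrite quad => le0; have q0 : (w^T *m A i *m w) 0 0 = 0 by nra.
have /(_ w) := psdmx_isotropic (psd _ te).
rewrite quad q0 mulr0 => /(_ erefl).
rewrite mulmxDl A0w add0r -scalemxAl => /eqP.
by rewrite scaler_eq0 gt_eqF //= => /eqP.
Qed.

End Pencils.

(** * The Arveson boundary of the dehomogenization as a kernel condition *)

Section ArvesonBoundary.
Variables (R : realType) (g d : nat) (A0 : 'M[R]_d) (A : 'I_g -> 'M[R]_d).
Hypothesis sA : forall i, symmx (A i).
Hypothesis posA : positive_hspec A0 A.

(** Blocks are extracted by multiplication with isometries because products, unlike block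
    decompositions, pass through [*t]. *)
Definition inj_ul n m : 'M[R]_(n + m, n) := col_mx 1%:M 0.
Definition inj_dr n m : 'M[R]_(n + m, m) := col_mx 0 1%:M.

Lemma block_mx_inj n m (a : 'M[R]_n) b c (e : 'M[R]_m) :
  block_mx a b c e =
  inj_ul n m *m a *m (inj_ul n m)^T + inj_ul n m *m b *m (inj_dr n m)^T +
  (inj_dr n m *m c *m (inj_ul n m)^T + inj_dr n m *m e *m (inj_dr n m)^T).
Proof.
rewrite /inj_ul /inj_dr !tr_col_mx !trmx0 !trmx1 -!mulmxA !mul_mx_row.
rewrite !mul_col_mx !mulmx1 !mulmx0 !mul0mx !mul1mx -!block_mxEh.
rewrite !add_block_mx.
by rewrite !addr0 !add0r.
Qed.

Lemma inj_ulE n m : (inj_ul n m)^T *m inj_ul n m = 1%:M.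
Proof. by rewrite /inj_ul tr_col_mx mul_row_col trmx1 mulmx1 mulmx0 addr0. Qed.

Lemma inj_dr_ul n m : (inj_dr n m)^T *m inj_ul n m = 0.
Proof.
by rewrite /inj_dr /inj_ul tr_col_mx mul_row_col trmx0 mul0mx mulmx0 addr0.
Qed.

Lemma block_mx_ul n m (a : 'M[R]_n) b c (e : 'M[R]_m) :
  (inj_ul n m)^T *m block_mx a b c e *m inj_ul n m = a.
Proof.
rewrite /inj_ul tr_col_mx mul_row_block mul_row_col trmx1 trmx0.
by rewrite !mul1mx !mul0mx !addr0 mulmx1 mulmx0 addr0.
Qed.

Lemma block_mx_dl n m (a : 'M[R]_n) b c (e : 'M[R]_m) :
  (inj_dr n m)^T *m block_mx a b c e *m inj_ul n m = c.
Proof.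
rewrite /inj_ul /inj_dr tr_col_mx mul_row_block mul_row_col trmx1 trmx0.
by rewrite !mul1mx !mul0mx !add0r mulmx1 mulmx0 addr0.
Qed.

Lemma block_mx_dr n m (a : 'M[R]_n) b c (e : 'M[R]_m) :
  (inj_dr n m)^T *m block_mx a b c e *m inj_dr n m = e.
Proof.
rewrite /inj_dr tr_col_mx mul_row_block mul_row_col trmx1 trmx0.
by rewrite !mul1mx !mul0mx !add0r mulmx0 mulmx1 add0r.
Qed.

(** A kernel vector padded by zeros is isotropic for the pencil of the dilation, hence in its
    kernel; the lower block of this equation is the claim. *)
Lemma dehomog_block_ker n m (Y : 'I_g -> 'M[R]_n) (b : 'I_g -> 'M[R]_(n, m)) e :
  dehomog A0 A (fun i => block_mx (Y i) (b i) (b i)^T (e i)) ->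
  ker_sub (pencil A0 A 1%:M Y) (linpencil A (fun i => (b i)^T)).
Proof.
set Z := fun i => _; case=> _ _ pZ v Mv.
set J1 := 1%:M *t inj_ul n m : 'M_(d * (n + m), d * n).
set J2 := 1%:M *t inj_dr n m : 'M_(d * (n + m), d * m).
have ME : pencil A0 A 1%:M Y = J1^T *m pencil A0 A 1%:M Z *m J1.
  rewrite -pencil_congr mulmx1 inj_ulE; congr pencil.
  by apply/funext => i; rewrite block_mx_ul.
have LE : linpencil A (fun i => (b i)^T) = J2^T *m pencil A0 A 1%:M Z *m J1.
  rewrite trmx_tens trmx1 pencilE mulmxDr mulmxDl !tensmx_mul.
  rewrite !mulmx1 inj_dr_ul tensmx0 add0r -linpencil_mul; congr linpencil.
  by apply/funext => i; rewrite block_mx_dl.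
have ZJv : pencil A0 A 1%:M Z *m (J1 *m v) = 0.
  apply: psdmx_isotropic => //.
  rewrite trmx_mul !mulmxA -(mulmxA _ J1^T) -(mulmxA _ _ J1) -ME.
  by rewrite -mulmxA Mv mulmx0 mxE.
by rewrite LE -!mulmxA ZJv mulmx0.
Qed.

(* With [A_i = A0 C_i], [Q = sum_i C_i *t b_i] and [B = A0 *t 1], the pencil of
   the dilation is
   [J1 (M - e^2 Q^T B Q) J1^T + (J2^T + e Q J1^T)^T B (J2^T + e Q J1^T)],
   where [J1] and [J2] embed the two diagonal blocks. *)
Lemma dehomog_block_exists n (Y b : 'I_g -> 'M[R]_n) :
  dehomog A0 A Y -> ker_sub (pencil A0 A 1%:M Y) (linpencil A b) ->
  exists2 e : R, e != 0 & dehomog A0 A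
    (fun i => block_mx (Y i) (e *: (b i)^T) (e *: (b i)^T)^T 0).
Proof.
move=> [_ sY pM] kb; set M := pencil A0 A 1%:M Y in pM kb.
have sA0 : A0^T = A0 by have [] := psdmx_tens1 (positive_hspec_psd 1 posA).
have /choice[C AC] i : exists K, A i = A0 *m K.
  have [K AK] := ker_subP (positive_hspec_ker i posA).
  by exists K^T; rewrite -{1}sA0 -trmx_mul -AK sA.
pose B := A0 *t (1%:M : 'M[R]_n).
have pB : psdmx B by exact: (positive_hspec_psd n posA).
pose Q := linpencil C b.
have bE : linpencil A b = B *m Q.
  rewrite mulmx_sumr; apply: eq_bigr => i _.
  by rewrite tensmx_mul mul1mx -AC.
have sP : symmx (Q^T *m B *m Q) by have [] := psdmx_congr Q pB.
have kP : ker_sub M (Q^T *m B *m Q).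
  move=> v /kb; rewrite bE => Bv.
  by rewrite -!mulmxA (mulmxA B) Bv mulmx0.
(* Domination bounds the square of the scale of the off-diagonal block, hence the root. *)
have [e e0 pMe] := psdmx_dominate pM sP kP; pose r := Num.sqrt e.
have r0 : r != 0 by rewrite gt_eqF // sqrtr_gt0.
exists r => //; split=> [|i|]; first exact: trmx1.
  by rewrite /symmx tr_block_mx sY trmxK trmx0.
set J1 := 1%:M *t inj_ul n n : 'M_(d * (n + n), d * n).
set J2 := 1%:M *t inj_dr n n : 'M_(d * (n + n), d * n).
have trJ1 : 1%:M *t (inj_ul n n)^T = J1^T by rewrite trmx_tens trmx1.
have trJ2 : 1%:M *t (inj_dr n n)^T = J2^T by rewrite trmx_tens trmx1.
have ZE : (fun i => block_mx (Y i) (r *: (b i)^T) (r *: (b i)^T)^T 0) =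
    (fun i => inj_ul n n *m Y i *m (inj_ul n n)^T
              + r *: (inj_ul n n *m (b i)^T *m (inj_dr n n)^T)
              + r *: (inj_dr n n *m b i *m (inj_ul n n)^T)).
  apply/funext => i; rewrite linearZ /= trmxK block_mx_inj.
  by rewrite mulmx0 mul0mx addr0 -!scalemxAr -!scalemxAl.
have BE : A0 *t (1%:M : 'M_(n + n)) = J1 *m B *m J1^T + J2 *m B *m J2^T.
  rewrite -trJ1 -trJ2 !tensmx_mul !mulmx1 mul1mx -tensmxDr; congr (_ *t _).
  rewrite scalar_mx_block block_mx_inj !mulmx1 !mulmx0 !mul0mx.
  by rewrite addr0 add0r.
have -> : pencil A0 A 1%:M
    (fun i => block_mx (Y i) (r *: (b i)^T) (r *: (b i)^T)^T 0) =
    J1 *m (M - e *: (Q^T *m B *m Q)) *m J1^T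
    + (J2^T + r *: Q *m J1^T)^T *m B *m (J2^T + r *: Q *m J1^T).
  rewrite ZE pencilE BE !linpencilD !linpencilZ !linpencil_mul linpencil_tr //.
  rewrite bE trJ1 trJ2 /M pencilE -/B trmx_mul.
  have [-> _] := pB.
  have -> : (J2^T + r *: Q *m J1^T)^T = J2 + r *: (J1 *m Q^T).
    rewrite [LHS]linearD /= trmxK trmx_mul trmxK [(_ *: _)^T]linearZ /=.
    by rewrite scalemxAr.
  have -> : e = r * r by rewrite -expr2 sqr_sqrtr // ltW.
  rewrite !mulmxDr !mulmxDl mulmxN mulNmx -!scalemxAl -!scalemxAr -!scalemxAl.
  rewrite !scalerA !mulmxA.
  move: (J1 *m B *m _) (J2 *m B *m J2^T) (J2 *m B *m Q *m _) => T1 T2 T3.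
  rewrite -/J1; move: (J1 *m Q^T *m B *m Q *m _) (J1 *m Q^T *m B *m _) => T4 T5.
  move: (J1 *m linpencil A Y *m _) => T6.
  by apply/matrixP => k l; rewrite !mxE; ring.
apply: psdmxD; last exact: psdmx_congr.
by have := psdmx_congr J1^T pMe; rewrite trmxK.
Qed.

Lemma arveson_dehomogP n (Y : 'I_g -> 'M[R]_n) : (0 < n)%N ->
  arveson (dehomog A0 A) Y <->
  dehomog A0 A Y /\
  forall b : 'I_g -> 'M[R]_n,
    ker_sub (pencil A0 A 1%:M Y) (linpencil A b) -> forall i, b i = 0.
Proof.
move=> n0; split=> [[KY arvY]|[KY kerY]]; split=> //.
  move=> b kb i; have [e e0 Kb] := dehomog_block_exists KY kb.
  have /(_ i)/eqP := arvY _ _ _ n0 (fun _ => trmx0 _ _ _) Kb.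
  by rewrite scaler_eq0 (negPf e0) trmx_eq0 => /eqP.
move=> m b e _ _ Kb i; apply/matrixP => s j; rewrite mxE.
(* The kernel condition concerns square tuples only. [D] places row j of the transposed block in the
   first row of an n by n matrix, a row that exists since [0 < n]. *)
pose D : 'M[R]_(n, m) := delta_mx (Ordinal n0) j.
have /(_ i)/matrixP/(_ (Ordinal n0) s) : forall i, D *m (b i)^T = 0.
  apply: kerY => v /(dehomog_block_ker Kb) bv.
  have := linpencil_mul A D (fun i => (b i)^T) 1%:M.
  rewrite (_ : (fun i => _) = (fun i => D *m (b i)^T)); last first.
    by apply/funext => k; rewrite mulmx1.
  by move=> ->; rewrite tensmx11 mulmx1 -mulmxA bv mulmx0.
rewrite [in X in X -> _]mxE (bigD1 j) //= big1 ?addr0.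
  by rewrite !mxE !eqxx mul1r.
by move=> k kj; rewrite !mxE (negPf kj) andbF mul0r.
Qed.

End ArvesonBoundary.

(** * Passage to the homogeneous Arveson boundary *)

Section HomogeneousArvesonBoundary.
Variables (R : realType) (g d : nat) (A0 : 'M[R]_d) (A : 'I_g -> 'M[R]_d).
Hypothesis sA : forall i, symmx (A i).
Hypothesis posA : positive_hspec A0 A.

Lemma hspec_dehomog n (X0 : 'M[R]_n) X : pdmx X0 -> hspec A0 A X0 X ->
  dehomog A0 A (fun i => inv_sqrtmx X0 *m X i *m inv_sqrtmx X0).
Proof.
move=> pX0 /(hspec_congr (inv_sqrtmx X0)).
by rewrite inv_sqrtmx_sym // inv_sqrtmx_congr.
Qed.

Lemma arveson_hspecP n (X0 : 'M[R]_n) X (Y : 'I_g -> 'M[R]_n) :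
  (0 < n)%N -> hspec A0 A X0 X -> pdmx X0 ->
  (forall i, Y i = inv_sqrtmx X0 *m X i *m inv_sqrtmx X0) ->
  arveson_hspec A0 A X0 X <->
  forall b : 'I_g -> 'M[R]_n,
    ker_sub (pencil A0 A 1%:M Y) (linpencil A b) -> forall i, b i = 0.
Proof.
move=> n0 hX pX0 /funext YE.
have KY : dehomog A0 A Y by rewrite YE; exact: hspec_dehomog.
split=> [|kerY]; last first.
  (* The zero summand is taken empty; [row_mx] supplies an identity with n + 0 columns without a
     cast. *)
  exists n, 0%N, (row_mx 1%:M 0), X0, X.
  have UE m (M : 'M[R]_n) :
      (row_mx 1%:M 0)^T *m M *m row_mx 1%:M (0 : 'M_(n, m)) = block_mx M 0 0 0.
    rewrite tr_row_mx trmx1 trmx0 mul_col_mx mul_col_row !mul1mx !mul0mx.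
    by rewrite mulmx1 mulmx0.
  split=> //; [split=> //; split| |].
  - rewrite -[X in X *m _]mulmx1 UE scalar_mx_block; congr block_mx.
    by apply/matrixP => -[].
  - by rewrite tr_row_mx mul_row_col trmx1 trmx0 mulmx1 mulmx0 addr0.
  - by move=> i; exact: UE.
  - by rewrite -YE; apply/(arveson_dehomogP sA posA).
case=> k [l [U [Y0 [Z [[k0 oU] UX0 UX pY0 arvZ]]]]] b kb i.
have [UtU UUt] := oU.
(* The columns of U belonging to the zero summand are isotropic for the positive definite X0, so
   they vanish. Hence the remaining columns V already form an orthogonal matrix. *)
have ortho_dr : U *m inj_dr R k l = 0.
  apply/matrixP => r j; rewrite [RHS]mxE.
  have : U *m inj_dr R k l *m delta_mx j 0 = 0 :> 'cV_n.
    apply/eqP; apply: contraT => /(proj2 pX0).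
    rewrite !trmx_mul !mulmxA -(mulmxA _ U^T) -(mulmxA _ _ U) UX0.
    by rewrite -!(mulmxA (delta_mx j 0)^T) block_mx_dr mul0mx mulmx0 mxE ltxx.
  by rewrite -colE => /colP/(_ r); rewrite !mxE.
pose V := U *m inj_ul R k l.
have VtV : V^T *m V = 1%:M.
  by rewrite trmx_mul mulmxA -(mulmxA _ U^T) UtU mulmx1 inj_ulE.
have UV : U = V *m (inj_ul R k l)^T.
  rewrite -[LHS]mulmx1 scalar_mx_block block_mx_inj !mulmx1 !mulmx0 !mul0mx.
  by rewrite addr0 add0r mulmxDr !mulmxA ortho_dr mul0mx addr0.
have VVt : V *m V^T = 1%:M.
  rewrite -UUt [in RHS]UV [in RHS]trmx_mul trmxK mulmxA.
  by rewrite -(mulmxA V) inj_ulE mulmx1.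
have VX (M : 'M[R]_n) N : U^T *m M *m U = block_mx N 0 0 0 -> V^T *m M *m V = N.
  move=> UM; rewrite trmx_mul !mulmxA -(mulmxA _ U^T) -(mulmxA _ _ U) UM.
  exact: block_mx_ul.
have Y0E := VX _ _ UX0; have ZE i := VX _ _ (UX i).
clearbody V.
have ZY : (fun i => inv_sqrtmx Y0 *m Z i *m inv_sqrtmx Y0) =
    (fun i => V^T *m Y i *m V).
  apply/funext => j; rewrite -Y0E inv_sqrtmx_orthogonal ?Y0E // -ZE YE.
  rewrite !mulmxA -(mulmxA _ V) VVt mulmx1 -!mulmxA; congr (_ *m _).
  by rewrite (mulmxA V) VVt mul1mx.
move: arvZ; rewrite ZY => /(arveson_dehomogP sA posA _ k0)[_ kerZ].
(* The kernel condition is invariant under conjugation: [1%:M *t V] maps the kernel of the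
   conjugated pencil into that of the original one. *)
have VbV : V^T *m b i *m V = 0.
  apply: (kerZ (fun i => V^T *m b i *m V)) => v.
  rewrite -{1}VtV -{1}(mulmx1 V^T) pencil_congr linpencil_mul -!mulmxA => Mv.
  rewrite kb ?mulmx0 //; move: Mv => /(congr1 (mulmx (1%:M *t V))).
  rewrite trmx_tens trmx1 mulmx0 !mulmxA tensmx_mul.
  by rewrite mulmx1 VVt tensmx11 mul1mx.
have -> : b i = V *m (V^T *m b i *m V) *m V^T.
  by rewrite !mulmxA VVt mul1mx -mulmxA VVt mulmx1.
by rewrite VbV mulmx0 mul0mx.
Qed.

End HomogeneousArvesonBoundary.

(** * The characterization by kernel conditions for all m *)

Theorem theorem2p5 (R : realType) (g d n : nat)
    (A0 : 'M[R]_d) (A : 'I_g -> 'M[R]_d)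
    (X0 : 'M[R]_n) (X : 'I_g -> 'M[R]_n)
    (hmin : minimal_defining A0 A)
    (hpos : positive_hspec A0 A)
    (hbdd : bounded_hspec A0 A)
    (hn : (0 < n)%N)
    (hX : hspec A0 A X0 X)
    (hX0 : pdmx X0) :
  let Y := fun i : 'I_g => inv_sqrtmx X0 *m X i *m inv_sqrtmx X0 in
  arveson_hspec A0 A X0 X <->
  forall m : nat, (m <= n)%N ->
    forall beta : 'I_g -> 'M[R]_n,
      ker_sub (pencil A0 A 1%:M Y) (pencil A0 A (pid_mx m) beta) <->
      (forall i, beta i =
         \matrix_(r < n, s < n) (if (r < m)%N then Y i r s else 0)).
Proof.
move=> Y; have [_ sA _] := hmin.
have topE m i :
    \matrix_(r < n, s < n) (if (r < m)%N then Y i r s else 0) = pid_mx m *m Y i.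
  apply/matrixP => r s; rewrite [LHS]mxE [RHS]mxE (bigD1 r) //=.
  rewrite big1 ?addr0 => [|j jr].
    by rewrite [pid_mx m r r]mxE eqxx /=; case: ifP; rewrite ?mul1r ?mul0r.
  by rewrite mxE eq_sym (inj_eq val_inj) (negPf jr) mul0r.
apply: iff_trans (arveson_hspecP sA hpos hn hX hX0 (fun=> erefl)) _.
split=> [kerY m _ b|kerY b kb i]; last first.
  (* At m = 0 the A0 term disappears and the prescribed tuple is zero. *)
  rewrite ((kerY 0%N (leq0n n) b).1 _ i).
    by apply/matrixP => r s; rewrite !mxE.
  by move=> v /kb; rewrite pencilE pid_mx_0 tensmx0 add0r.
split=> [kb i|bE v Yv]; last first.
  have -> : b = (fun i => pid_mx m *m Y i)
    by apply/funext => i; rewrite bE topE.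
  by rewrite pencil_mull -mulmxA Yv mulmx0.
rewrite topE; apply/eqP; rewrite -subr_eq0; apply/eqP.
(* Both tuples satisfy the inclusion for the same [pid_mx m], so the A0 terms cancel in their
   difference. *)
apply: (kerY (fun i => b i - pid_mx m *m Y i)) => v Yv.
have -> : linpencil A (fun i => b i - pid_mx m *m Y i) =
    pencil A0 A (pid_mx m) b -
    pencil A0 A (pid_mx m) (fun i => pid_mx m *m Y i).
  rewrite !pencilE opprD addrACA subrr add0r -scaleN1r -linpencilZ -linpencilD.
  by congr linpencil; apply/funext => j; rewrite scaleN1r.
by rewrite mulmxBl (kb v Yv) pencil_mull -mulmxA Yv mulmx0 subrr.
Qed.
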